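(* Let $\Delta$ be a finite set of globally consistent conditional domain constraints (CDCs), X-UINDs and Y-UINDs over $R$ (i.e. $\mathrm{cdc}(\Delta)$ is globally consistent), such that the set of CDCs and Y-UINDs in $\Delta$ is dp-controllable. Then the UINDs (X-UINDs and Y-UINDs) are $\{(\mathrm{dp})\}$-separable in $\Delta$ from the CDCs; that is, every horizontal decomposition of $R$ is lossless under $\Delta$ if and only if it is lossless under $\mathrm{cdc}(\Delta^* )$, where $\Delta^*$ is the closure of $\Delta$ under the domain propagation rule $(\mathrm{dp})$.
   Context: Setting. $\mathbf{dom}$ is a (possibly infinite) set of values; $\mathbf{idom}$ is a set of values from a specific interpreted domain (e.g. $\mathbb Z$) on which predicates and functions are defined according to a first-order language $\mathfrak C$ closed under negation. $R$ is a relation symbol of arity $n$ whose first $k$ positions are non-interpreted (values from $\mathbf{dom}$) and whose remaining $n-k$ positions are interpreted (values from $\mathbf{idom}$). Variables $\overline x=(x_1,\dots,x_k)$ refer to non-interpreted positions, $\overline y=(y_1,\dots,y_{n-k})$ to interpreted ones ($y_i$ refers to position $k+i$). $\mathfrak C$-formulae have free variables among $\overline y$. All instances (associating relation symbols with subsets of $\mathbf{dom}^k\times\mathbf{idom}^{n-k}$) are finite; entailment $\models$ is with respect to finite instances. $\{R(\overline t)\}$ denotes the instance whose only tuple is $\overline t$ in $R$. A CDC is a formula $\forall\overline x,\overline y.\,(R(\overline x,\overline y)\land\lambda(\overline x))\to\delta(\overline y)$, written $\lambda(\overline x)\to\delta(\overline y)$, where $\lambda$ is a Boolean combination of equalities $x_i=a$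 with $a\in\mathbf{dom}$ (possibly $\top$) and $\delta(\overline y)\in\mathfrak C$. $\mathrm{cdc}(\Gamma)$ is the set of all CDCs in $\Gamma$. A set of CDCs is globally consistent if for every $\overline t_x\in\mathbf{dom}^k$ there is $\overline t_y\in\mathbf{idom}^{n-k}$ such that the instance $\{R(\overline t_x,\overline t_y)\}$ satisfies it. An X-UIND $R[x_i]\subseteq R[x_j]$ (resp. Y-UIND $R[y_i]\subseteq R[y_j]$) is a unary inclusion dependency between non-interpreted (resp. interpreted) positions: it is satisfied by $I$ if every value in column $i$ (resp. $i+k$) of $R^I$ appears in column $j$ (resp. $j+k$) of $R^I$. A horizontal decomposition $\Sigma$ is a finite set of view definitions, one for each view symbol $V_1,\dots,V_m$ (each of the same arity and position types as $R$), of the form $\forall\overline x,\overline y.\,V_i(\overline x,\overline y)\leftrightarrow(R(\overline x,\overline y)\land\lambda_i(\overline x)\land\sigma_i(\overline y))$, with $\lambda_i$ a Boolean combination of equalities as for CDCs (possibly $\top$) and $\sigma_i\in\mathfrak C$; the conjunct $\sigma_i$ may be absent. $\Sigma$ is lossless under a set $\Gamma$ of constraints over $R$ if $\Gamma\cup\Sigma\models\forall\overline x,\overline y.\,R(\overline x,\overline y)\leftrightarrow\bigvee_iV_i(\overline x,\overline y)$. Domain propagation rule $(\mathrm{dp})$: from a CDC $\top\to\delta(y_i)$ (where $y_i$ is the only free variable of $\delta$) and a Y-UIND $R[y_j]\subseteq R[y_i]$, derive the CDC $\top\to\delta(y_j)$, where the $\mathfrak C$-formula $\delta(y_j)$ is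 obtained by replacing $y_i$ with $y_j$. dp-controllable: a set of CDCs and Y-UINDs is dp-controllable if, for every Y-UIND $R[y_i]\subseteq R[y_j]$ in it with $i\ne j$, all CDCs in it mentioning the variable $y$, where $y$ is $y_i$ or $y_j$, are of the form $\top\to\delta(y)$ (with $y$ the only free variable of $\delta$). Separability: for a finite set $\mathcal S$ of sound inference rules, the constraints in $\Delta$ other than CDCs are $\mathcal S$-separable in $\Delta$ from the CDCs if every horizontal decomposition is lossless under $\Delta$ exactly when it is lossless under $\mathrm{cdc}(\Delta^* )$, with $\Delta^*$ the closure of $\Delta$ under $\mathcal S$. *)

(* Defs.v *)
From HB Require Import structures.
From mathcomp Require Import all_boot.
From mathcomp Require Import boolp classical_sets functions cardinality.

Set Implicit Arguments.
Unset Strict Implicit.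
Unset Printing Implicit Defensive.

Local Open Scope classical_set_scope.

(* First-order syntax over the interpreted domain. [form L p] is well scoped:
   its free variables are y_0, ..., y_(p-1), as elements of 'I_p, and under a
   quantifier ord0 is the bound variable while y_i becomes [lift ord0 i]. *)

Record signature := Signature {
  fsym : Type;
  far : fsym -> nat;
  psym : Type;
  par : psym -> nat }.

Record structure (L : signature) (D : Type) := Structure {
  fint : forall f : fsym L, ('I_(far f) -> D) -> D;
  pint : forall P : psym L, ('I_(par P) -> D) -> Prop }.

Inductive term (L : signature) (p : nat) : Type :=
| Var of 'I_p
| App (f : fsym L) of ('I_(far f) -> term L p).

Inductive form (L : signature) : nat -> Type :=
| FTrue p : form L p
| FPred p (P : psym L) of ('I_(par P) -> term L p) : form L p
| FEq p of term L p & term L p : form L p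
| FNot p of form L p : form L p
| FAnd p of form L p & form L p : form L p
| FOr p of form L p & form L p : form L p
| FAll p of form L p.+1 : form L p
| FEx p of form L p.+1 : form L p.

Fixpoint tfv (L : signature) p (t : term L p) : {set 'I_p} :=
  match t with
  | Var i => [set i]%SET
  | App f a => (\bigcup_(j < far f) tfv (a j))%SET
  end.

Fixpoint fv (L : signature) p (d : form L p) : {set 'I_p} :=
  match d with
  | FTrue _ => finset.set0
  | FPred _ P a => (\bigcup_(j < par P) tfv (a j))%SET
  | FEq _ s t => (tfv s :|: tfv t)%SET
  | FNot _ d1 => fv d1
  | FAnd _ d1 d2 | FOr _ d1 d2 => (fv d1 :|: fv d2)%SET
  | FAll _ d1 | FEx _ d1 => [set i | lift ord0 i \in fv d1]%SET
  end.

Definition scons (T : Type) p (a : T) (e : 'I_p -> T) (i : 'I_p.+1) : T :=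
  oapp e a (unlift ord0 i).

Fixpoint teval (L : signature) D (A : structure L D) p (e : 'I_p -> D)
    (t : term L p) : D :=
  match t with
  | Var i => e i
  | App f a => fint A (fun j => teval A e (a j))
  end.

Fixpoint eval (L : signature) D (A : structure L D) p (d : form L p) :
    ('I_p -> D) -> Prop :=
  match d with
  | FTrue _ => fun=> True
  | FPred _ P a => fun e => pint A (fun j => teval A e (a j))
  | FEq _ s t => fun e => teval A e s = teval A e t
  | FNot _ d1 => fun e => ~ eval A d1 e
  | FAnd _ d1 d2 => fun e => eval A d1 e /\ eval A d2 e
  | FOr _ d1 d2 => fun e => eval A d1 e \/ eval A d2 e
  | FAll _ d1 => fun e => forall a, eval A d1 (scons a e)
  | FEx _ d1 => fun e => exists a, eval A d1 (scons a e)
  end.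

Fixpoint tren (L : signature) p q (f : 'I_p -> 'I_q) (t : term L p) :
    term L q :=
  match t with
  | Var i => Var L (f i)
  | App g a => App (fun j => tren f (a j))
  end.

Fixpoint ren (L : signature) p (d : form L p) :
    forall q, ('I_p -> 'I_q) -> form L q :=
  match d with
  | FTrue _ => fun q _ => FTrue L q
  | FPred _ P a => fun q f => FPred (fun j => tren f (a j))
  | FEq _ s t => fun q f => FEq (tren f s) (tren f t)
  | FNot _ d1 => fun q f => FNot (ren d1 f)
  | FAnd _ d1 d2 => fun q f => FAnd (ren d1 f) (ren d2 f)
  | FOr _ d1 d2 => fun q f => FOr (ren d1 f) (ren d2 f)
  | FAll _ d1 => fun q f => FAll (ren d1 (scons ord0 (lift ord0 \o f)))
  | FEx _ d1 => fun q f => FEx (ren d1 (scons ord0 (lift ord0 \o f)))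
  end.

(* Replaces the free occurrences of y_i with y_j. *)
Definition replace_var (L : signature) p (i j : 'I_p) (d : form L p) :
    form L p := ren d (fun l => if l == i then j else l).

Definition neg_closed (L : signature) p (C : set (form L p)) : Prop :=
  forall d, C d -> C (FNot d).

Inductive bform (dom : Type) (k : nat) : Type :=
| BTrue
| BEq of 'I_k & dom
| BNot of bform dom k
| BAnd of bform dom k & bform dom k
| BOr of bform dom k & bform dom k.

Arguments BTrue {dom k}.

Fixpoint beval dom k (l : bform dom k) (x : k.-tuple dom) : Prop :=
  match l with
  | BTrue => True
  | BEq i a => tnth x i = a
  | BNot l1 => ~ beval l1 x
  | BAnd l1 l2 => beval l1 x /\ beval l2 x
  | BOr l1 l2 => beval l1 x \/ beval l2 x
  end.

(* R has k non-interpreted positions followed by p interpreted ones, so its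
   arity is n = k + p. *)
Definition row (dom idom : Type) (k p : nat) : Type :=
  (k.-tuple dom * p.-tuple idom)%type.

Inductive constraint (dom : Type) (L : signature) (k p : nat) : Type :=
| CDC of bform dom k & form L p
| XUIND of 'I_k & 'I_k
| YUIND of 'I_p & 'I_p.

Arguments XUIND {dom L k p} _ _.
Arguments YUIND {dom L k p} _ _.

Definition sat dom idom (L : signature) (A : structure L idom) k p
    (r : set (row dom idom k p)) (c : constraint dom L k p) : Prop :=
  match c with
  | CDC l d => forall t, r t -> beval l t.1 -> eval A d (tnth t.2)
  | XUIND i j =>
      forall t, r t -> exists2 s, r s & tnth s.1 j = tnth t.1 i
  | YUIND i j =>
      forall t, r t -> exists2 s, r s & tnth s.2 j = tnth t.2 i
  end.

Definition cdc dom (L : signature) k p (G : set (constraint dom L k p)) :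
    set (constraint dom L k p) :=
  [set c | G c /\ if c is CDC _ _ then True else False].

Definition yuind dom (L : signature) k p (G : set (constraint dom L k p)) :
    set (constraint dom L k p) :=
  [set c | G c /\ if c is YUIND _ _ then True else False].

(* The C-formulae are a set C of first-order formulae; membership is a separate
   condition so that constraints can be built by purely syntactic operations;
   in particular C need not be closed under variable replacement for the
   domain propagation rule to be defined. *)
Definition cdcs_over dom (L : signature) k p (C : set (form L p))
    (G : set (constraint dom L k p)) : Prop :=
  forall l d, G (CDC l d) -> C d.

Definition globally_consistent dom idom (L : signature) (A : structure L idom)
    k p (G : set (constraint dom L k p)) : Prop :=
  forall tx : k.-tuple dom, exists ty : p.-tuple idom,
    forall c, G c -> sat A [set (tx, ty)] c.

Definition dp_controllable dom (L : signature) k p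
    (G : set (constraint dom L k p)) : Prop :=
  forall i j : 'I_p, i != j -> G (YUIND i j) ->
  forall y : 'I_p, y = i \/ y = j ->
  forall l d, G (CDC l d) -> y \in fv d -> l = BTrue /\ fv d = [set y]%SET.

Record view (dom : Type) (L : signature) (k p : nat) := View {
  vlambda : bform dom k;
  vsigma : option (form L p) }.

Definition hdecomp (dom : Type) (L : signature) (k p m : nat) : Type :=
  'I_m -> view dom L k p.

Definition hdecomp_over dom (L : signature) k p m (C : set (form L p))
    (Sigma : hdecomp dom L k p m) : Prop :=
  forall i s, vsigma (Sigma i) = Some s -> C s.

Inductive symbol (m : nat) : Type := RSym | VSym of 'I_m.

Arguments RSym {m}.

Record instance (dom idom : Type) (k p m : nat) := Instance {
  rel :> symbol m -> set (row dom idom k p);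
  rel_finite : forall s, finite_set (rel s) }.

Definition sat_view dom idom (L : signature) (A : structure L idom) k p m
    (I : instance dom idom k p m) (i : 'I_m) (v : view dom L k p) : Prop :=
  forall t, I (VSym i) t <->
    [/\ I RSym t, beval (vlambda v) t.1 &
        if vsigma v is Some s then eval A s (tnth t.2) else True].

Definition lossless dom idom (L : signature) (A : structure L idom) k p m
    (G : set (constraint dom L k p)) (Sigma : hdecomp dom L k p m) : Prop :=
  forall I : instance dom idom k p m,
    (forall c, G c -> sat A (I RSym) c) ->
    (forall i, sat_view A I i (Sigma i)) ->
    forall t, I RSym t <-> exists i, I (VSym i) t.

Record sound_rule dom idom (L : signature) (A : structure L idom) (k p : nat)
    := SoundRule {
  derives : set (constraint dom L k p) -> constraint dom L k p -> Prop;
  derives_sound : forall P c, derives P c ->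
    forall r : set (row dom idom k p), finite_set r ->
    (forall q, P q -> sat A r q) -> sat A r c }.

Inductive closure dom idom (L : signature) (A : structure L idom) k p
    (S : set (sound_rule dom A k p)) (G : set (constraint dom L k p)) :
    constraint dom L k p -> Prop :=
| closure_base c : G c -> closure S G c
| closure_step r P c : S r -> derives r P c ->
    (forall q, P q -> closure S G q) -> closure S G c.

Inductive dp_derives dom (L : signature) k p :
    set (constraint dom L k p) -> constraint dom L k p -> Prop :=
| DpDerives (i j : 'I_p) (d : form L p) : fv d = [set i]%SET ->
    dp_derives [set CDC BTrue d; YUIND j i] (CDC BTrue (replace_var i j d)).

Lemma eq_teval (L : signature) D (A : structure L D) p (e1 e2 : 'I_p -> D)
    (t : term L p) :
  {in tfv t, e1 =1 e2} -> teval A e1 t = teval A e2 t.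
Proof.
elim: t => [i|f a IH] /= e12; first by apply: e12; rewrite finset.inE.
congr (fint A _); apply/funext => j; apply: IH => i ij.
by apply: e12; apply/bigcupP; exists j.
Qed.

Lemma eq_eval (L : signature) D (A : structure L D) p (d : form L p)
    (e1 e2 : 'I_p -> D) :
  {in fv d, e1 =1 e2} -> eval A d e1 <-> eval A d e2.
Proof.
have inU q (X Y : {set 'I_q}) (f g : 'I_q -> D) :
    {in (X :|: Y)%SET, f =1 g} -> {in X, f =1 g} /\ {in Y, f =1 g}.
  by move=> fg; split=> i iX; apply: fg; rewrite finset.inE iX ?orbT.
have inS q (X : {set 'I_q.+1}) (f g : 'I_q -> D) a :
    {in [set i | lift ord0 i \in X]%SET, f =1 g} ->
    {in X, scons a f =1 scons a g}.
  move=> fg i iX; rewrite /scons; case: unliftP => [j|] ij //=.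
  by apply: fg; rewrite finset.inE -ij.
elim: d e1 e2 => {p} [p|p P a|p s t|p d IH|p d IHd c IHc|p d IHd c IHc|
  p d IH|p d IH] e1 e2 /=.
- by [].
- move=> e12; suff -> : (fun j => teval A e1 (a j)) =
    (fun j => teval A e2 (a j)) by [].
  apply/funext => j; apply: eq_teval => i ij; apply: e12.
  by apply/bigcupP; exists j.
- by move=> /inU[es et]; rewrite (eq_teval A es) (eq_teval A et).
- by move=> /IH e12; split=> h /e12.
- by move=> /inU[/IHd [? ?] /IHc[? ?]]; split=> -[? ?]; split; auto.
- by move=> /inU[/IHd [? ?] /IHc[? ?]]; split=> -[?|?]; auto.
- by move=> e12; split=> h a; apply/(IH _ _ (inS _ _ _ _ a e12)).
- by move=> e12; split=> -[a h]; exists a; apply/(IH _ _ (inS _ _ _ _ a e12)).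
Qed.

Lemma teval_ren (L : signature) D (A : structure L D) p q (f : 'I_p -> 'I_q)
    (e : 'I_q -> D) (t : term L p) :
  teval A e (tren f t) = teval A (e \o f) t.
Proof.
elim: t => [//|g a IH] /=.
by congr (fint A _); apply/funext => j; rewrite IH.
Qed.

Lemma eval_ren (L : signature) D (A : structure L D) p (d : form L p) q
    (f : 'I_p -> 'I_q) (e : 'I_q -> D) :
  eval A (ren d f) e <-> eval A d (e \o f).
Proof.
have up n m (g : 'I_n -> 'I_m) (e' : 'I_m -> D) a :
    scons a e' \o scons ord0 (lift ord0 \o g) = scons a (e' \o g).
  apply/funext => i; rewrite /scons /=.
  by case: (unliftP ord0 i) => [j|] _ /=; rewrite ?liftK ?unlift_none.
elim: d q f e => {p} [p|p P a|p s t|p d IH|p d IHd c IHc|p d IHd c IHc|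
  p d IH|p d IH] q f e /=.
- by [].
- suff -> : (fun j => teval A e (tren f (a j))) =
    (fun j => teval A (e \o f) (a j)) by [].
  by apply/funext => j; rewrite teval_ren.
- by rewrite !teval_ren.
- by rewrite IH.
- by rewrite IHd IHc.
- by rewrite IHd IHc.
- by split=> h a; move: (h a); rewrite IH up.
- by split=> -[a h]; exists a; move: h; rewrite IH up.
Qed.

Lemma dp_sound dom idom (L : signature) (A : structure L idom) k p P c :
  @dp_derives dom L k p P c ->
  forall r : set (row dom idom k p), finite_set r ->
  (forall q, P q -> sat A r q) -> sat A r c.
Proof.
case=> i j d fvd r _ hP t rt _.
have [s rs sE] := hP (YUIND j i) (or_intror erefl) t rt.
have hs := hP (CDC BTrue d) (or_introl erefl) s rs Logic.I.
rewrite eval_ren; apply/(eq_eval _ _).1: hs => l.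
by rewrite fvd finset.inE => /eqP -> /=; rewrite eqxx.
Qed.

Definition dp dom idom (L : signature) (A : structure L idom) k p :
    sound_rule dom A k p := SoundRule (@dp_sound dom idom L A k p).

(* The constraints of G other than CDCs are S-separable in G from the CDCs. *)
Definition separable dom idom (L : signature) (A : structure L idom) k p
    (C : set (form L p)) (S : set (sound_rule dom A k p))
    (G : set (constraint dom L k p)) : Prop :=
  forall m (Sigma : hdecomp dom L k p m), hdecomp_over C Sigma ->
    lossless A G Sigma <-> lossless A (cdc (closure S G)) Sigma.

(* Main.v *)
(** View definitions are conditions on individual tuples, so it suffices that
    every tuple [t] satisfying the CDCs of the (dp)-closure of [Delta] lies in a
    finite model of [Delta].  In that model the non-interpreted parts range over
    all tuples of values of [t.1], which gives the X-UINDs, and each is completed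
    by global consistency.
    Positions in a nontrivial Y-UIND are overwritten independently: position [l]
    takes the values of [t] at all positions from which [l] is reachable along
    Y-UINDs.  This gives the Y-UINDs; by dp-controllability only CDCs
    [BTrue -> d(y_l)] restrict position [l], and (dp) carries each of them back
    to the position of [t] that the value comes from. *)

Require Import Defs.
From HB Require Import structures.
From mathcomp Require Import all_boot.
From mathcomp Require Import boolp classical_sets functions cardinality.

Lemma tfv_tren (L : signature) (p q : nat) (f : 'I_p -> 'I_q) (t : term L p) :
  tfv (tren f t) = (f @: tfv t)%SET.
Proof.
elim: t => [i|g a IH] /=; first by rewrite imset_set1.
apply/setP => x; apply/bigcupP/imsetP => [[j _]|[y /bigcupP[j _ yj] ->]].
  by rewrite IH => /imsetP[y yj ->]; exists y => //; apply/bigcupP; exists j.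
by exists j => //; rewrite IH imset_f.
Qed.

(** Needed to iterate (dp): the derived formula again has exactly one free variable, as the next
    application requires. *)
Lemma fv_ren (L : signature) (p : nat) (d : form L p) (q : nat)
    (f : 'I_p -> 'I_q) : fv (ren d f) = (f @: fv d)%SET.
Proof.
have up n m (g : 'I_n -> 'I_m) (X : {set 'I_n.+1}) :
    ([set i | lift ord0 i \in scons ord0 (lift ord0 \o g) @: X] =
     g @: [set i | lift ord0 i \in X])%SET.
  apply/setP => x; rewrite finset.inE.
  apply/imsetP/imsetP => [[y yX]|[y]].
    rewrite /scons; case: unliftP => [z|] yE /=; last first.
      by move/eqP; rewrite eq_sym (negbTE (neq_lift _ _)).
    by move=> /lift_inj ->; exists z => //; rewrite finset.inE -yE.
  rewrite finset.inE => yX ->; exists (lift ord0 y) => //.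
  by rewrite /scons liftK.
elim: d q f => {p} [p|p P a|p s t|p d IH|p d IHd c IHc|p d IHd c IHc|
  p d IH|p d IH] q f /=.
- by rewrite imset0.
- apply/setP => x; apply/bigcupP/imsetP => [[j _]|[y /bigcupP[j _ yj] ->]].
    rewrite tfv_tren => /imsetP[y yj ->]; exists y => //.
    by apply/bigcupP; exists j.
  by exists j => //; rewrite tfv_tren imset_f.
- by rewrite !tfv_tren imsetU.
- exact: IH.
- by rewrite IHd IHc imsetU.
- by rewrite IHd IHc imsetU.
- by rewrite IH up.
- by rewrite IH up.
Qed.

Section Separability.
Local Open Scope classical_set_scope.
Variables (dom idom : Type) (L : signature) (A : structure L idom) (k p : nat).
Implicit Types (G : set (constraint dom L k p)) (r : set (row dom idom k p)).

Lemma closure_sat (S : set (sound_rule dom A k p)) G r :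
  finite_set r -> (forall c, G c -> sat A r c) ->
  forall c, Defs.closure S G c -> sat A r c.
Proof.
move=> rfin rG c; elim=> {c} [c /rG //|R P c _ Pc _ IH].
exact: (derives_sound Pc).
Qed.

Definition yedge G : rel 'I_p := fun i j => `[< G (YUIND i j) >].

(** One application of (dp) per edge of the path. Only the value of the single free variable
    matters, which is why [e] and [e'] are compared at [j] and [i] alone. *)
Lemma dp_connect G (d : form L p) (i j : 'I_p) :
  G (CDC BTrue d) -> fv d = [set i]%SET -> connect (yedge G) j i ->
  exists2 d', Defs.closure [set dp dom A k p] G (CDC BTrue d') &
    forall e e' : 'I_p -> idom, e j = e' i -> eval A d' e -> eval A d e'.
Proof.
move=> Gd fvd /connectP[s js iE].
suff [d' [cl _ d'd]] : exists d', [/\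
    Defs.closure [set dp dom A k p] G (CDC BTrue d'),
    fv d' = [set j]%SET &
    forall e e' : 'I_p -> idom, e j = e' i -> eval A d' e -> eval A d e'].
  by exists d'.
elim: s j js iE => [|z s IH] j /=.
  move=> _ ij; rewrite -ij; exists d; split=> //; first exact: closure_base.
  move=> e e' ee'; apply/(eq_eval _ _).1 => l.
  by rewrite fvd finset.inE => /eqP ->.
move=> /andP[/asboolP jz zs] /(IH _ zs)[d' [cl fvd' d'd]].
exists (replace_var z j d'); split.
- apply: (@closure_step _ _ _ _ _ _ [set dp dom A k p] G (dp dom A k p)
    [set CDC BTrue d'; YUIND j z]); [by []|exact: DpDerives|].
  by move=> q [] -> //; exact: closure_base.
- by rewrite fv_ren fvd' imset_set1 eqxx.
- by move=> e e' ee' /eval_ren; apply: d'd => /=; rewrite eqxx.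
Qed.

Lemma tuple_model G (t : row dom idom k p) :
  globally_consistent A (cdc G) -> dp_controllable (cdc G `|` yuind G) ->
  (forall c, cdc (Defs.closure [set dp dom A k p] G) c -> sat A [set t] c) ->
  exists r, [/\ finite_set r, r t & forall c, G c -> sat A r c].
Proof.
case: t => tx ty Gcons Gctrl tG.
(* Global consistency gives some completion of each [u]; at [tx] it is fixed to be [ty], so that [t]
   itself becomes a row. *)
have /choice[f fP] : forall u, exists v, (u = tx -> v = ty) /\
    forall c, cdc G c -> sat A [set (u, v)] c.
  move=> u; have [->|utx] := pselect (u = tx); last first.
    by have [v ?] := Gcons u; exists v.
  exists ty; split=> // c [Gc ccdc]; apply: tG; split=> //; exact: closure_base.
pose E := yedge G.
pose ctrl l := [exists j, (j != l) && (E l j || E j l)].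
have ctrl_CDC l d y : G (CDC l d) -> y \in fv d -> ctrl y ->
    l = BTrue /\ fv d = [set y]%SET.
  move=> Gd yd /existsP[j /andP[jy /orP[]/asboolP Gyj]].
    by apply: (Gctrl y j) => //; [rewrite eq_sym|right|left|left].
  by apply: (Gctrl j y) => //; [right|right|left].
(* [a] and [g] record the position of [t] from which a value is copied; both range over finite
   types, so the model is finite. *)
pose X (a : {ffun 'I_k -> 'I_k}) := [tuple tnth tx (a l) | l < k].
pose Y a (g : {ffun 'I_p -> 'I_p}) :=
  [tuple if ctrl l then tnth ty (g l) else tnth (f (X a)) l | l < p].
pose good := [set ag : {ffun 'I_k -> 'I_k} * {ffun 'I_p -> 'I_p} |
  forall l, connect E (ag.2 l) l].
exists [set (X ag.1, Y ag.1 ag.2) | ag in good]; split.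
- exact/finite_image/finite_finset.
- exists ([ffun l => l], [ffun l => l]) => [l|] /=; first by rewrite ffunE.
  have Xid : X [ffun l => l] = tx.
    by apply: eq_from_tnth => l; rewrite tnth_mktuple ffunE.
  congr pair => //; apply: eq_from_tnth => l.
  by rewrite tnth_mktuple ffunE Xid (fP tx).1 ?if_same.
case=> [l d|i j|i j] Gc /= _ [[a g] /= gP <-] /=.
(* If [d] mentions a controlled [y], it mentions nothing else, and [dp_connect] carries it to
   position [g y] of [t]. Otherwise the row agrees with [f (X a)] on [fv d]. *)
- move=> lX; have [/existsP[y /andP[yd cy]]|/existsPn nctrl] :=
    boolP [exists y, (y \in fv d) && ctrl y].
    have [lT fvd] := ctrl_CDC _ _ _ Gc yd cy; rewrite lT in Gc.
    have [d' cl d'd] := dp_connect _ _ _ _ Gc fvd (gP y).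
    apply: (d'd (tnth ty)); first by rewrite tnth_mktuple cy.
    exact: (tG (CDC BTrue d') (conj cl Logic.I) _ erefl).
  have := (fP (X a)).2 _ (conj Gc Logic.I) _ erefl lX.
  apply/(eq_eval _ _).1 => y yd /=; rewrite tnth_mktuple.
  by have := nctrl y; rewrite yd /= => /negbTE ->.
(* A constant [a] puts the required value in every non-interpreted column, [j] included. *)
- exists (X [ffun => a i], Y [ffun => a i] g).
    by exists ([ffun => a i], g).
  by rewrite !tnth_mktuple ffunE.
- have [<-|ij] := eqVneq i j; first by exists (X a, Y a g) => //; exists (a, g).
  have Eij : E i j by exact/asboolP.
  have ci : ctrl i by apply/existsP; exists j; rewrite eq_sym ij Eij.
  have cj : ctrl j by apply/existsP; exists i; rewrite ij Eij orbT.
  (* Position [j] now copies from the source of [i], which reaches [j] through the edge from [i]. *)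
  pose g' := [ffun l => if l == j then g i else g l].
  exists (X a, Y a g'); last by rewrite !tnth_mktuple ci cj ffunE eqxx.
  exists (a, g') => // l /=; rewrite ffunE; case: eqP => [->|_]; last exact: gP.
  exact/(connect_trans (gP i))/connect1.
Qed.

(** Interpreting the view symbols over [r] by their definitions gives a finite instance. The
    conclusion no longer mentions [r], so it transfers to any instance containing [t]. *)
Lemma lossless_tuple G (m : nat) (Sigma : hdecomp dom L k p m) r
    (t : row dom idom k p) :
  lossless A G Sigma -> finite_set r -> (forall c, G c -> sat A r c) -> r t ->
  exists i, beval (vlambda (Sigma i)) t.1 /\
    (if vsigma (Sigma i) is Some s then eval A s (tnth t.2) else True).
Proof.
move=> Gloss rfin rG rt.
pose I s := match s with
  | RSym => r
  | VSym i => [set u | [/\ r u, beval (vlambda (Sigma i)) u.1 &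
      if vsigma (Sigma i) is Some s then eval A s (tnth u.2) else True]]
  end.
have Ifin s : finite_set (I s).
  by case: s => [//|i]; apply: sub_finite_set rfin => u [].
have [/(_ rt)[i [_ ? ?]] _] :=
  Gloss (Instance Ifin) rG (fun=> fun=> iff_refl _) t.
by exists i.
Qed.

End Separability.

Theorem theorem10 (dom idom : Type) (L : signature) (A : structure L idom)
    (k p : nat) (C : set (form L p)) (C_neg : neg_closed C)
    (Delta : set (constraint dom L k p))
    (Delta_finite : finite_set Delta)
    (Delta_over : cdcs_over C Delta)
    (Delta_consistent : globally_consistent A (cdc Delta))
    (Delta_controllable :
       dp_controllable (setU (cdc Delta) (yuind Delta))) :
  separable C (set1 (dp dom A k p)) Delta.
Proof.
move=> m Sigma _; split=> Gloss I IG IS t; last first.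
  apply: Gloss => // c [cl _]; apply: closure_sat cl => //; exact: rel_finite.
split=> [It|[i /IS[]//]].
(* Here [I] is only known to satisfy the CDCs of the closure. Its tuple [t] is placed in a model [r]
   of [Delta], and the view found there also captures [t] in [I]. *)
have [|r [rfin rt rD]] := tuple_model _ _ _ _ _ _ _ t Delta_consistent
    Delta_controllable.
  case=> [l d|? ?|? ?] c; try by case: c.
  by move=> _ -> lt; exact: (IG _ c).
have [i [lt st]] := lossless_tuple _ _ _ _ _ _ _ _ _ _ _ Gloss rfin rD rt.
by exists i; apply/IS; split.
Qed.
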